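(* Let $p,q\ge 3$. The set of $1$-trivial motions of size-$2$ psd factorizations of matrices in $\mathcal{M}_{3,2}^{p \times q}$, each motion being identified with its associated matrix $D\in\mathbb{R}^{3\times 3}$ (equivalently with the pair $(D,-D)$), is equal to $L_{(I,I)}\mathcal{M}_{\mathrm{GL}(2)}$, i.e. it is the linear subspace spanned by the matrices $$D_1=\begin{pmatrix}2&0&0\\0&0&0\\0&0&1\end{pmatrix},\quad D_2=\begin{pmatrix}0&0&0\\0&2&0\\0&0&1\end{pmatrix},\quad D_3=\begin{pmatrix}0&0&0\\0&0&\sqrt2\\\sqrt2&0&0\end{pmatrix},\quad D_4=\begin{pmatrix}0&0&\sqrt2\\0&0&0\\0&\sqrt2&0\end{pmatrix}.$$
   Context: $\mathcal{S}^2$ (resp. $\mathcal{S}^2_+$) is the set of real symmetric (resp. symmetric positive semidefinite, psd) $2\times2$ matrices; $\langle X,Y\rangle=\operatorname{trace}(XY)$. A size-$k$ psd factorization of a nonnegative $p\times q$ matrix $M$ is a tuple $A^{(1)},\dots,A^{(p)},B^{(1)},\dots,B^{(q)}$ of $k\times k$ psd matrices with $M_{ij}=\langle A^{(i)},B^{(j)}\rangle$; the psd rank of $M$ is the smallest such $k$. $\mathcal{M}_{3,2}^{p\times q}$ is the set of nonnegative $p\times q$ matrices of rank $3$ and psd rank $2$. For $s\in\{1,2\}$, an $s$-infinitesimal motion of a size-$2$ psd factorization is a tuple $(\dot A^{(1)},\dots,\dot A^{(p)},\dot B^{(1)},\dots,\dot B^{(q)})$ of matrices in $\mathcal{S}^2$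 such that (1) $\langle\dot A^{(i)},B^{(j)}\rangle+\langle A^{(i)},\dot B^{(j)}\rangle=0$ for all $i,j$; and (2) there is $\varepsilon>0$ such that for all $t\in[0,\varepsilon)$ and all nonempty $I\subseteq\{1,2\}$, $T^s([A^{(i)}+t\dot A^{(i)}]_I)\ge0$ for all $i$ and $T^s([B^{(j)}+t\dot B^{(j)}]_I)\ge0$ for all $j$. Here $[X]_I$ is the principal minor of $X$ with index set $I$, and $T^s(f)$ is the Taylor polynomial of order $s$ at $t=0$ of the polynomial $f(t)$. Put $\operatorname{vec}(X)=(X_{11},X_{22},\sqrt2X_{12})$ (row vector). If $M\in\mathcal{M}_{3,2}^{p\times q}$, every $s$-infinitesimal motion is given by a unique $D\in\mathbb{R}^{3\times3}$ via $\operatorname{vec}(\dot A^{(i)})=\operatorname{vec}(A^{(i)})D$ and $\operatorname{vec}(\dot B^{(j)})^T=-D\operatorname{vec}(B^{(j)})^T$. The motion is $s$-trivial if the same $D$ gives, by these formulas, an $s$-infinitesimal motion of every size-$2$ psd factorization of every matrix in $\mathcal{M}_{3,2}^{p\times q}$. For $S\in\mathrm{GL}(2)$ let $C_S\in\mathbb{R}^{3\times 3}$ be the matrix with $\operatorname{vec}(S^TXS)=\operatorname{vec}(X)C_S$ for all $X\in\mathcal{S}^2$; $\mathcal{M}_{\mathrm{GL}(2)}=\{(C_S,C_S^{-1}):S\in\mathrm{GL}(2)\}$, and $L_{(I,I)}\mathcal{M}_{\mathrm{GL}(2)}$ is the linear space of tangent directions of $\mathcal{M}_{\mathrm{GL}(2)}$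 at $(I,I)$; its elements have the form $(D,-D)$. *)

(* Defs.v *)
From HB Require Import structures.
From mathcomp Require Import all_boot all_order all_algebra.
From mathcomp Require Import sesquilinear.
From mathcomp Require Import all_classical all_reals all_analysis.
Set Implicit Arguments.
Unset Strict Implicit.
Unset Printing Implicit Defensive.
Import Order.TTheory GRing.Theory Num.Theory.
Import numFieldNormedType.Exports.
Local Open Scope classical_set_scope.
Local Open Scope ring_scope.

Definition psd (R : realType) (k : nat) (X : 'M[R]_k) : Prop :=
  X \is symmetricmx /\ forall v : 'rV[R]_k, 0 <= (v *m X *m v^T) 0 0.

Definition psd_factorization (R : realType) (p q k : nat) (M : 'M[R]_(p, q))
    (A : 'I_p -> 'M[R]_k) (B : 'I_q -> 'M[R]_k) : Prop :=
  [/\ forall i, psd (A i), forall j, psd (B j)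
    & forall i j, M i j = \tr (A i *m B j)].

Definition has_psd_factorization (R : realType) (p q : nat) (M : 'M[R]_(p, q))
    (k : nat) : Prop :=
  exists (A : 'I_p -> 'M[R]_k) (B : 'I_q -> 'M[R]_k), psd_factorization M A B.

Definition psd_rank_is (R : realType) (p q : nat) (M : 'M[R]_(p, q)) (k : nat)
    : Prop :=
  has_psd_factorization M k /\
  forall k', has_psd_factorization M k' -> (k <= k')%N.

Definition M32 (R : realType) (p q : nat) : set 'M[R]_(p, q) :=
  [set M : 'M[R]_(p, q) |
    [/\ forall i j, 0 <= M i j, \rank M = 3%N & psd_rank_is M 2]].

Definition principal_minor (S : comNzRingType) (k : nat) (I : {set 'I_k})
    (X : 'M[S]_k) : S :=
  \det (mxsub (fun a : 'I_#|I| => enum_val a) (fun a : 'I_#|I| => enum_val a) X).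

(* The minor [X + t dX]_I, as a polynomial in t. *)
Definition minor_poly (R : realType) (k : nat) (I : {set 'I_k})
    (X dX : 'M[R]_k) : {poly R} :=
  principal_minor I (map_mx polyC X + 'X *: map_mx polyC dX).

(* take_poly s.+1 drops the monomials of degree > s, i.e. it is the Taylor
   polynomial of order s at 0. *)
Definition minors_nonneg_to_order (R : realType) (s : nat) (X dX : 'M[R]_2)
    (t : R) : Prop :=
  forall I : {set 'I_2}, I != finset.set0 ->
    0 <= (take_poly s.+1 (minor_poly I X dX)).[t].

Definition infinitesimal_motion (R : realType) (s p q : nat)
    (A : 'I_p -> 'M[R]_2) (B : 'I_q -> 'M[R]_2)
    (dA : 'I_p -> 'M[R]_2) (dB : 'I_q -> 'M[R]_2) : Prop :=
  [/\ forall i, dA i \is symmetricmx,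
      forall j, dB j \is symmetricmx,
      forall i j, \tr (dA i *m B j) + \tr (A i *m dB j) = 0
    & exists2 eps : R, 0 < eps & forall t : R, 0 <= t < eps ->
        (forall i, minors_nonneg_to_order s (A i) (dA i) t) /\
        (forall j, minors_nonneg_to_order s (B j) (dB j) t)].

Definition vec (R : realType) (X : 'M[R]_2) : 'rV[R]_3 :=
  \row_(k < 3) [:: X ord0 ord0; X ord_max ord_max;
                   Num.sqrt 2 * X ord0 ord_max]`_k.

(* vec is injective on symmetric matrices, so for symmetric dA, dB the
   velocities are determined by D. *)
Definition given_by (R : realType) (p q : nat) (D : 'M[R]_3)
    (A : 'I_p -> 'M[R]_2) (B : 'I_q -> 'M[R]_2)
    (dA : 'I_p -> 'M[R]_2) (dB : 'I_q -> 'M[R]_2) : Prop :=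
  (forall i, vec (dA i) = vec (A i) *m D) /\
  (forall j, (vec (dB j))^T = - D *m (vec (B j))^T).

Definition gives_motion (R : realType) (s p q : nat) (D : 'M[R]_3)
    (A : 'I_p -> 'M[R]_2) (B : 'I_q -> 'M[R]_2) : Prop :=
  exists (dA : 'I_p -> 'M[R]_2) (dB : 'I_q -> 'M[R]_2),
    given_by D A B dA dB /\ infinitesimal_motion s A B dA dB.

(* The matrices D of the s-trivial motions: D comes from a motion of some
   size-2 psd factorization of some matrix in M32, and gives a motion of every
   such factorization. *)
Definition trivial_motions (R : realType) (s p q : nat) : set 'M[R]_3 :=
  [set D |
    (exists (M : 'M[R]_(p, q)) (A : 'I_p -> 'M[R]_2) (B : 'I_q -> 'M[R]_2),
       [/\ M32 M, psd_factorization M A B & gives_motion s D A B]) /\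
    (forall (M : 'M[R]_(p, q)) (A : 'I_p -> 'M[R]_2) (B : 'I_q -> 'M[R]_2),
       M32 M -> psd_factorization M A B -> gives_motion s D A B)].
Arguments trivial_motions : clear implicits.

(* C is the matrix C_S of the congruence X |-> S^T X S in the coordinates vec;
   since vec maps the symmetric matrices onto R^3, C is determined by S. *)
Definition congruence_mx (R : realType) (S : 'M[R]_2) (C : 'M[R]_3) : Prop :=
  forall X : 'M[R]_2, X \is symmetricmx -> vec (S^T *m X *m S) = vec X *m C.

Definition M_GL2 (R : realType) : set ('M[R]_3 * 'M[R]_3)%type :=
  [set P | exists (S : 'M[R]_2) (C : 'M[R]_3),
     [/\ S \in unitmx, congruence_mx S C & P = (C, invmx C)]].
Arguments M_GL2 : clear implicits.

(* Tangent directions of N at x: velocities at x of curves in N through x. *)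
Definition tangent_directions (R : realType) (V : normedModType R) (N : set V)
    (x : V) : set V :=
  [set v | exists gamma : R -> V,
     [/\ gamma 0 = x, \forall t \near (0 : R), N (gamma t)
       & is_derive (0 : R) (1 : R) gamma v]].

Definition mx_of_rows (R : realType) (rows : seq (seq R)) : 'M[R]_3 :=
  \matrix_(i < 3, j < 3) (nth [::] rows i)`_j.

(* D1, D2, D3, D4 are the velocities at S = I of S |-> C_S in the directions
   E11, E22, E21, E12. *)
Definition D1 (R : realType) : 'M[R]_3 :=
  mx_of_rows [:: [:: 2; 0; 0];
                 [:: 0; 0; 0];
                 [:: 0; 0; 1]].

Definition D2 (R : realType) : 'M[R]_3 :=
  mx_of_rows [:: [:: 0; 0; 0];
                 [:: 0; 2; 0];
                 [:: 0; 0; 1]].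

Definition D3 (R : realType) : 'M[R]_3 :=
  mx_of_rows [:: [:: 0; 0; 0];
                 [:: 0; 0; Num.sqrt 2];
                 [:: Num.sqrt 2; 0; 0]].

Definition D4 (R : realType) : 'M[R]_3 :=
  mx_of_rows [:: [:: 0; 0; Num.sqrt 2];
                 [:: 0; 0; 0];
                 [:: 0; Num.sqrt 2; 0]].

(* Main.v *)
Require Import Defs.
From HB Require Import structures.
From mathcomp Require Import all_boot all_order all_algebra.
From mathcomp Require Import perm sesquilinear.
From mathcomp Require Import all_classical all_reals all_analysis.
From mathcomp Require Import ring lra.
Set Implicit Arguments.
Unset Strict Implicit.
Unset Printing Implicit Defensive.
Import Order.TTheory GRing.Theory Num.Theory.
Import numFieldNormedType.Exports.
Local Open Scope classical_set_scope.
Local Open Scope ring_scope.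

(** Identify a symmetric matrix [X] with [vec X]. Then [2 det X] becomes the
    quadratic form [2 x0 x1 - x2^2] of signature (1, 2), whose matrix is called
    [J] below, and the rank one psd matrices become its isotropic vectors. Both
    descriptions of the trivial motions are compared with one linear space, the
    [conformal] matrices [D]: those with [D J + J D^T] proportional to [J].

    Why trivial motions are conformal. To first order only a singular matrix [X]
    of a factorization is constrained: its determinant must not decrease. For
    [X = x x^T] this says [y^T dX y >= 0] with [y] orthogonal to [x]. The velocity
    of the factor [x x^T] on the [A] side and that of the factor [y y^T] on the
    [B] side are both read off the same number [vec (x x^T) D vec (y y^T)^T], with
    opposite signs. So a [D] that moves every factorization makes this number
    vanish for every [x]. For [x = (1, s)] it is a quartic polynomial in [s], and
    its five coefficients vanish exactly when [D] is conformal
    ([quartic_eq0_conformal]). All these pairs [x, y] occur in factorizations of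
    the one matrix [(i - j)^2], from [A_i = x x^T] with [x = (1, s + i)] and
    [B_j = y y^T] with [y = (- (s + j), 1)], since the inner product of these
    vectors is [i - j] ([diff_sq_factorization], [M32_diff_sq]).

    Conversely a conformal velocity multiplies the determinant by a scalar to
    first order ([polar_det_velocity]), so singular matrices stay singular to
    first order, and the other minors stay nonnegative for a short time; the
    velocity [- D^T] of the other side is conformal too
    ([conformal_gives_motion]).

    Why tangent directions are conformal. A congruence multiplies the determinant
    by [det S ^ 2], so [C_S J C_S^T] is proportional to [J]; differentiating this
    at the identity, along any curve, gives the conformal equations
    ([tangent_conformal]). Conversely every conformal matrix is the derivative of
    [C_S] along [S = 1 + t E] for some [E] ([conformalP], [dcongruence_tangent]),
    and the four entries of [E] are its coordinates on [D1, D2, D3, D4], up to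
    order ([span_dcongruence]). *)

(** * Symmetric 2 x 2 matrices as vectors *)

Local Notation j0 := (ord0 : 'I_3).
Local Notation j1 := (Ordinal (isT : (1 < 3)%N)).
Local Notation j2 := (ord_max : 'I_3).

Lemma ord2P (P : 'I_2 -> Prop) : P ord0 -> P ord_max -> forall i, P i.
Proof.
move=> P0 P1 [[|[|//]] lti2].
- by rewrite (_ : Ordinal lti2 = ord0) //; apply: val_inj.
- by rewrite (_ : Ordinal lti2 = ord_max) //; apply: val_inj.
Qed.

Lemma ord3P (P : 'I_3 -> Prop) : P j0 -> P j1 -> P j2 -> forall i, P i.
Proof.
move=> P0 P1 P2 [[|[|[|//]]] lti3].
- by rewrite (_ : Ordinal lti3 = j0) //; apply: val_inj.
- by rewrite (_ : Ordinal lti3 = j1) //; apply: val_inj.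
- by rewrite (_ : Ordinal lti3 = j2) //; apply: val_inj.
Qed.

Lemma sum_ord2 (V : nmodType) (F : 'I_2 -> V) :
  \sum_(i < 2) F i = F ord0 + F ord_max.
Proof. by rewrite big_ord_recr big_ord1 /=; congr (F _ + _); apply: val_inj. Qed.

Lemma sum_ord3 (V : nmodType) (F : 'I_3 -> V) :
  \sum_(i < 3) F i = F j0 + F j1 + F j2.
Proof.
by rewrite !big_ord_recr big_ord0 /= add0r; congr (F _ + F _ + F _); apply: val_inj.
Qed.

Lemma mx2P (T : Type) (X Y : 'M[T]_2) :
  X ord0 ord0 = Y ord0 ord0 -> X ord0 ord_max = Y ord0 ord_max ->
  X ord_max ord0 = Y ord_max ord0 -> X ord_max ord_max = Y ord_max ord_max ->
  X = Y.
Proof. by move=> *; apply/matrixP; do 2 apply: ord2P. Qed.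

Lemma det_mx22 (S : comNzRingType) (X : 'M[S]_2) :
  \det X = X ord0 ord0 * X ord_max ord_max - X ord0 ord_max * X ord_max ord0.
Proof.
rewrite (expand_det_row _ ord0) sum_ord2 /cofactor !det_mx11 !mxE /=.
rewrite expr0 expr1 mul1r mulN1r mulrN.
by congr (_ * X _ _ - _ * X _ _); apply: val_inj.
Qed.

Lemma symmetric_mx2P (R : realType) (X : 'M[R]_2) :
  X \is symmetricmx <-> X ord_max ord0 = X ord0 ord_max.
Proof.
rewrite qualifE /= expr0 scale1r.
split=> [/eqP/matrixP/(_ ord_max ord0)|XE]; first by rewrite !mxE.
by apply/eqP/mx2P; rewrite !mxE /= ?XE.
Qed.

Lemma vecE (R : realType) (X : 'M[R]_2) :
  [/\ vec X 0 j0 = X ord0 ord0, vec X 0 j1 = X ord_max ord_max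
    & vec X 0 j2 = Num.sqrt 2 * X ord0 ord_max].
Proof. by split; rewrite mxE. Qed.

Lemma sqrt2_sq (R : realType) : Num.sqrt 2 * Num.sqrt 2 = 2 :> R.
Proof. by rewrite -expr2 sqr_sqrtr. Qed.

Lemma sqrt2_neq0 (R : realType) : Num.sqrt 2 != 0 :> R.
Proof. by rewrite gt_eqF // sqrtr_gt0. Qed.

(** The inverse of [vec] on symmetric matrices. *)
Definition unvec (R : realType) (r : 'rV[R]_3) : 'M[R]_2 :=
  \matrix_(i < 2, j < 2)
    (if i != j then (Num.sqrt 2)^-1 * r 0 j2
     else if i == ord0 then r 0 j0 else r 0 j1).

Lemma unvec_sym (R : realType) (r : 'rV[R]_3) : unvec r \is symmetricmx.
Proof. by apply/symmetric_mx2P; rewrite !mxE. Qed.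

Lemma unvecK (R : realType) : cancel (@unvec R) (@vec R).
Proof.
move=> r; have [v0 v1 v2] := vecE (unvec r).
apply/rowP; apply: ord3P; rewrite ?v0 ?v1 ?v2 !mxE //=.
by rewrite mulVKf // sqrt2_neq0.
Qed.

Lemma vecK (R : realType) (X : 'M[R]_2) : X \is symmetricmx -> unvec (vec X) = X.
Proof.
move=> /symmetric_mx2P XE; have [v0 v1 v2] := vecE X.
by apply: mx2P; rewrite mxE /= ?v0 ?v1 ?v2 // ?XE mulKf // sqrt2_neq0.
Qed.

Lemma mxtrace_vec (R : realType) (X Y : 'M[R]_2) :
  X \is symmetricmx -> Y \is symmetricmx ->
  \tr (X *m Y) = (vec X *m (vec Y)^T) 0 0.
Proof.
move=> /symmetric_mx2P XE /symmetric_mx2P YE.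
have [v0 v1 v2] := vecE X; have [w0 w1 w2] := vecE Y.
rewrite /mxtrace sum_ord2 !mxE !sum_ord2 sum_ord3 !(mxE trmx_key).
rewrite ?v0 ?v1 ?v2 ?w0 ?w1 ?w2 XE YE.
have := sqrt2_sq R; move: (Num.sqrt 2) => s ss.
by transitivity (X ord0 ord0 * Y ord0 ord0
  + X ord_max ord_max * Y ord_max ord_max
  + (s * s) * (X ord0 ord_max * Y ord0 ord_max)); [rewrite ss|]; ring.
Qed.

(** * First order conditions on the minors *)

(** The derivative of the determinant at [X] in the direction [Y]. *)
Definition polar_det (R : realType) (X Y : 'M[R]_2) : R :=
  X ord0 ord0 * Y ord_max ord_max + X ord_max ord_max * Y ord0 ord0
  - X ord0 ord_max * Y ord_max ord0 - X ord_max ord0 * Y ord0 ord_max.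

Lemma principal_minor1 (S : comNzRingType) (k : nat) (i : 'I_k) (X : 'M[S]_k) :
  principal_minor (finset.set1 i) X = X i i.
Proof.
have det1 n (f : 'I_n -> 'I_k) : n = 1%N -> (forall a, f a = i) ->
    \det (mxsub f f X) = X i i.
  by move=> n1; subst n => fi; rewrite det_mx11 mxE !fi.
apply: det1 => [|a]; first by rewrite cards1.
by apply/eqP; have := enum_valP a; rewrite finset.in_set1.
Qed.

Lemma principal_minorT (S : comNzRingType) (k : nat) (X : 'M[S]_k) :
  principal_minor (finset.setTfor 'I_k) X = \det X.
Proof.
have detT n (f : 'I_n -> 'I_k) : n = k -> injective f ->
    \det (mxsub f f X) = \det X.
  move=> nk; subst n => injf.
  have -> : mxsub f f X = row_perm (perm injf) (col_perm (perm injf) X).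
    by apply/matrixP => i j; rewrite !mxE !permE.
  rewrite row_permE col_permE !det_mulmx !det_perm odd_permV mulrCA.
  by rewrite -signr_addb addbb mulr1.
by apply: detT; [rewrite finset.cardsT card_ord | exact: enum_val_inj].
Qed.

Lemma nonempty_ord2P (I : {set 'I_2}) : I != finset.set0 ->
  [\/ I = finset.set1 ord0, I = finset.set1 ord_max | I = finset.setTfor 'I_2].
Proof.
have I2 (J : {set 'I_2}) : (ord0 \in I) = (ord0 \in J) ->
  (ord_max \in I) = (ord_max \in J) -> I = J.
  by move=> *; apply/finset.setP; apply: ord2P.
case I0 : (ord0 \in I); case I1 : (ord_max \in I).
- by constructor 3; apply: I2; rewrite inE.
- by constructor 1; apply: I2; rewrite inE.
- by constructor 2; apply: I2; rewrite inE.
- by case/eqP; apply: I2; rewrite inE.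
Qed.

Lemma horner_take_poly2 (R : realType) (c0 c1 c2 t : R) :
  (take_poly 2 (c0%:P + c1%:P * 'X + c2%:P * 'X ^+ 2)).[t] = c0 + t * c1.
Proof.
have -> : take_poly 2 (c0%:P + c1%:P * 'X + c2%:P * 'X ^+ 2) = c0%:P + c1%:P * 'X.
  apply/polyP => i; rewrite coef_take_poly !coefD !coefCM coefX coefXn.
  by case: i => [|[|i]] /=; rewrite ?mulr0 ?mulr1 ?addr0 // coefC /= ?addr0.
by rewrite !hornerE mulrC.
Qed.

Lemma minors_nonneg1P (R : realType) (X dX : 'M[R]_2) (t : R) :
  minors_nonneg_to_order 1 X dX t <->
  [/\ 0 <= X ord0 ord0 + t * dX ord0 ord0,
      0 <= X ord_max ord_max + t * dX ord_max ord_max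
    & 0 <= \det X + t * polar_det X dX].
Proof.
have minor1 i : (take_poly 2 (minor_poly (finset.set1 i) X dX)).[t] =
    X i i + t * dX i i.
  rewrite /minor_poly principal_minor1 !mxE -(horner_take_poly2 _ _ 0).
  by rewrite polyC0 mul0r addr0 mulrC.
have minorT : (take_poly 2 (minor_poly (finset.setTfor 'I_2) X dX)).[t] =
    \det X + t * polar_det X dX.
  rewrite /minor_poly principal_minorT -(horner_take_poly2 _ _ (\det dX)).
  rewrite !det_mx22 !mxE /polar_det !(rmorphB, rmorphD, rmorphM) /=.
  by congr (take_poly _ _).[t]; ring.
split=> [H|[H0 H1 HT] I /nonempty_ord2P[] ->]; last 3 first.
- by rewrite minor1.
- by rewrite minor1.
- by rewrite minorT.
by split; rewrite -?minor1 -?minorT; apply: H; apply/finset.set0Pn;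
  [exists ord0 | exists ord_max | exists ord0]; rewrite inE.
Qed.

Lemma psd2P (R : realType) (X : 'M[R]_2) : psd X ->
  [/\ X ord_max ord0 = X ord0 ord_max, 0 <= X ord0 ord0,
      0 <= X ord_max ord_max & 0 <= \det X].
Proof.
case=> /symmetric_mx2P XE Xge0.
(* At [(- X 0 1, X 0 0)] this form is [X 0 0 * \det X], which settles the case
   [X 0 0 > 0]; at [(- (X 1 1 + 1), X 0 1)] it forces [X 0 1 = 0] otherwise. *)
have quad x y : 0 <= x ^+ 2 * X ord0 ord0 + 2 * x * y * X ord0 ord_max
    + y ^+ 2 * X ord_max ord_max.
  have := Xge0 (\row_(i < 2) if i == ord0 then x else y).
  rewrite !mxE !sum_ord2 !mxE !sum_ord2 !mxE /= XE; congr (_ <= _); ring.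
have X0 : 0 <= X ord0 ord0 by have := quad 1 0; lra.
have X1 : 0 <= X ord_max ord_max by have := quad 0 1; lra.
split=> //; rewrite det_mx22 XE.
move: (quad (- X ord0 ord_max) (X ord0 ord0)).
move: (quad (- (X ord_max ord_max + 1)) (X ord0 ord_max)).
move: X0 X1; move: (X ord0 ord0) (X ord_max ord_max) (X ord0 ord_max) => a b c.
rewrite le_eqVlt => /predU1P[<- b0 H _|a0 b0 _ H].
  have : c ^+ 2 * (b + 2) <= 0 by move: H; rewrite expr2; lra.
  by rewrite pmulr_lle0 ?ltr_wpDl // expr2 mul0r sub0r oppr_ge0.
rewrite -(pmulr_rge0 _ a0); move: H; congr (_ <= _); ring.
Qed.

(** * Conformal matrices give motions *)

(** The entries of [D J + J D^T = c J], where [J] is the matrix of the quadratic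
    form [2 x0 x1 - x2^2] and the scalar [c] has been eliminated. *)
Definition conformal (R : realType) (D : 'M[R]_3) : Prop :=
  [/\ D j0 j1 = 0, D j1 j0 = 0, D j0 j2 = D j2 j1, D j1 j2 = D j2 j0
    & D j0 j0 + D j1 j1 = 2 * D j2 j2].

Definition velocity (R : realType) (D : 'M[R]_3) (X : 'M[R]_2) : 'M[R]_2 :=
  unvec (vec X *m D).

Lemma velocityE (R : realType) (D : 'M[R]_3) (X : 'M[R]_2) :
  [/\ velocity D X ord0 ord0 = X ord0 ord0 * D j0 j0 + X ord_max ord_max * D j1 j0
        + Num.sqrt 2 * X ord0 ord_max * D j2 j0,
      velocity D X ord_max ord_max = X ord0 ord0 * D j0 j1 + X ord_max ord_max * D j1 j1
        + Num.sqrt 2 * X ord0 ord_max * D j2 j1,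
      2 * velocity D X ord0 ord_max = Num.sqrt 2 * (X ord0 ord0 * D j0 j2
        + X ord_max ord_max * D j1 j2 + Num.sqrt 2 * X ord0 ord_max * D j2 j2)
    & velocity D X ord_max ord0 = velocity D X ord0 ord_max].
Proof.
have [v0 v1 v2] := vecE X.
split; last by rewrite !mxE.
- by rewrite !mxE /= sum_ord3 v0 v1 v2.
- by rewrite !mxE /= sum_ord3 v0 v1 v2.
- rewrite !mxE /= sum_ord3 v0 v1 v2 mulrA; congr (_ * _).
  by apply: (mulIf (sqrt2_neq0 R)); rewrite mulfVK ?sqrt2_neq0 // sqrt2_sq.
Qed.

(** The determinant is half the form [J] of [vec X], and [D] preserves [J] up to
    scale. *)
Lemma polar_det_velocity (R : realType) (D : 'M[R]_3) (X : 'M[R]_2) :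
  conformal D -> X ord_max ord0 = X ord0 ord_max ->
  polar_det X (velocity D X) = (D j0 j0 + D j1 j1) * \det X.
Proof.
case=> d01 d10 d02 d12 d22 XE; have [P0 P1 P2 PE] := velocityE D X.
rewrite det_mx22 /polar_det PE XE P0 P1 d01 d10.
have -> (a c d : R) : a - c * d - c * d = a - c * (2 * d) by ring.
rewrite P2 d02 d12.
transitivity ((D j0 j0 + D j1 j1) *
    (X ord0 ord0 * X ord_max ord_max - X ord0 ord_max * X ord0 ord_max)
  + (D j0 j0 + D j1 j1 - Num.sqrt 2 * Num.sqrt 2 * D j2 j2) * X ord0 ord_max ^+ 2).
  ring.
by rewrite sqrt2_sq d22 subrr mul0r addr0.
Qed.

Lemma conformal_opp_tr (R : realType) (D : 'M[R]_3) :
  conformal D -> conformal (- D^T).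
Proof.
by case=> d01 d10 d02 d12 d22; split; rewrite !mxE; lra.
Qed.

Lemma near0_affine_ge0 (R : realType) (a b : R) :
  0 <= a -> (a = 0 -> b = 0) -> \forall t \near (0 : R), 0 <= t -> 0 <= a + t * b.
Proof.
rewrite le_eqVlt => /predU1P[<- /(_ erefl) ->|a0 _].
  by apply: (@filterE _ (nbhs (0 : R))) => t _; rewrite mulr0 addr0.
have : a + t * b @[t --> (0 : R)] --> a + 0 * b.
  by apply: cvgD; [exact: cvg_cst | apply: cvgMl; exact: cvg_id].
rewrite mul0r addr0 => /cvgr_gt /(_ _ a0).
by apply: filterS => t /ltW.
Qed.

(** A diagonal entry that vanishes forces the off-diagonal one to vanish, and then
    its velocity is zero because [D j0 j1 = D j1 j0 = 0]; the determinant has a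
    velocity proportional to itself. So each minor is either positive, or zero
    with zero velocity. *)
Lemma conformal_minors_nonneg (R : realType) (D : 'M[R]_3) (X : 'M[R]_2) :
  conformal D -> psd X ->
  \forall t \near (0 : R), 0 <= t -> minors_nonneg_to_order 1 X (velocity D X) t.
Proof.
move=> cD /psd2P[XE X0 X1 detX].
have det0 (u : R) : u * u = 0 -> u = 0 by move/eqP; rewrite mulf_eq0 orbb => /eqP.
have offdiag : X ord0 ord0 * X ord_max ord_max = 0 -> X ord0 ord_max = 0.
  move=> Xdiag; apply: det0; move: detX; rewrite det_mx22 Xdiag XE sub0r oppr_ge0.
  by move=> le0; apply/eqP; rewrite eq_le le0 -expr2 sqr_ge0.
have [P0 P1 _ _] := velocityE D X.
case: (cD) => d01 d10 _ _ _.
have N0 := @near0_affine_ge0 _ _ (velocity D X ord0 ord0) X0.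
have N1 := @near0_affine_ge0 _ _ (velocity D X ord_max ord_max) X1.
have ND := @near0_affine_ge0 _ _ (polar_det X (velocity D X)) detX.
have {}N0 := N0 _; have {}N1 := N1 _; have {}ND := ND _.
apply: filterS3 (N0 _) (N1 _) (ND _).
- by move=> t H0 H1 HD t0; apply/minors_nonneg1P; split; auto.
- by move=> X00; rewrite P0 X00 offdiag ?X00 ?mul0r // d10 !(mulr0, mul0r) !addr0.
- by move=> X11; rewrite P1 X11 offdiag ?X11 ?mulr0 // d01 !(mulr0, mul0r) !addr0.
- by move=> detX0; rewrite polar_det_velocity // detX0 mulr0.
Qed.

(** The [B] factors move by the contragredient action of [D], so both sides can be
    treated by results on one side. *)
Lemma given_byP (R : realType) (p q : nat) (D : 'M[R]_3)
    (A : 'I_p -> 'M[R]_2) (B : 'I_q -> 'M[R]_2)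
    (dA : 'I_p -> 'M[R]_2) (dB : 'I_q -> 'M[R]_2) :
  (forall i, dA i \is symmetricmx) -> (forall j, dB j \is symmetricmx) ->
  given_by D A B dA dB <->
  (forall i, dA i = velocity D (A i)) /\ (forall j, dB j = velocity (- D^T) (B j)).
Proof.
move=> symA symB; split=> -[HA HB]; split.
- by move=> i; rewrite /velocity -HA vecK.
- move=> j; rewrite /velocity -[vec _ *m _]trmxK trmx_mul linearN /= trmxK.
  by rewrite -HB trmxK vecK.
- by move=> i; rewrite HA unvecK.
- by move=> j; rewrite HB unvecK trmx_mul linearN /= trmxK.
Qed.

Lemma conformal_gives_motion (R : realType) (p q : nat) (D : 'M[R]_3)
    (A : 'I_p -> 'M[R]_2) (B : 'I_q -> 'M[R]_2) :
  conformal D -> (forall i, psd (A i)) -> (forall j, psd (B j)) ->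
  gives_motion 1 D A B.
Proof.
move=> cD psdA psdB; have cD' := conformal_opp_tr cD.
exists (fun i => velocity D (A i)), (fun j => velocity (- D^T) (B j)).
split; first by apply/given_byP => // k; exact: unvec_sym.
split; try by move=> k; exact: unvec_sym.
- move=> i j; have [symA _] := psdA i; have [symB _] := psdB j.
  rewrite !mxtrace_vec ?unvec_sym // !unvecK trmx_mul linearN /= trmxK.
  by rewrite mulNmx mulmxN mulmxA mxE [in X in _ + X]mxE mxE subrr.
- have NA : \forall t \near (0 : R), forall i, 0 <= t ->
      minors_nonneg_to_order 1 (A i) (velocity D (A i)) t.
    by apply: (@filter_forall R _ (fun i t => _) (nbhs (0 : R))) => i;
      exact: conformal_minors_nonneg.
  have NB : \forall t \near (0 : R), forall j, 0 <= t ->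
      minors_nonneg_to_order 1 (B j) (velocity (- D^T) (B j)) t.
    by apply: (@filter_forall R _ (fun j t => _) (nbhs (0 : R))) => j;
      exact: conformal_minors_nonneg.
  have N : \forall t \near (0 : R), 0 <= t ->
      (forall i, minors_nonneg_to_order 1 (A i) (velocity D (A i)) t) /\
      (forall j, minors_nonneg_to_order 1 (B j) (velocity (- D^T) (B j)) t).
    near=> t => t0.
    by split=> k; move: k t0; near: t.
  have /nbhs_ballP[e /= e0 He] := N.
  exists e => // t /andP[t0 te].
  by apply: He => //; rewrite /ball /= sub0r normrN ger0_norm.
Unshelve. all: by end_near. Qed.

(** * Motions of all factorizations are conformal *)

Lemma minors_nonneg_singular (R : realType) (eps : R) (X dX : 'M[R]_2) :
  0 < eps -> \det X = 0 ->
  (forall t, 0 <= t < eps -> minors_nonneg_to_order 1 X dX t) ->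
  0 <= polar_det X dX.
Proof.
move=> e0 detX H.
have /minors_nonneg1P[_ _] : minors_nonneg_to_order 1 X dX (eps / 2).
  by apply: H; rewrite divr_ge0 ?ltW //= ltr_pdivrMr // mulr_natr mulr2n ltrDl.
by rewrite detX add0r pmulr_rge0 // divr_gt0.
Qed.

Definition gram (R : realType) (x y : R) : 'M[R]_2 :=
  \matrix_(i < 2, j < 2)
    ((if i == ord0 then x else y) * (if j == ord0 then x else y)).

Lemma gramE (R : realType) (x y : R) :
  [/\ gram x y ord0 ord0 = x * x, gram x y ord_max ord_max = y * y,
      gram x y ord0 ord_max = x * y & gram x y ord_max ord0 = x * y].
Proof. by split; rewrite mxE //= mulrC. Qed.

Lemma psd_gram (R : realType) (x y : R) : psd (gram x y).
Proof.
split; first by apply/symmetric_mx2P; rewrite !mxE mulrC.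
move=> v; rewrite !mxE !sum_ord2 !mxE !sum_ord2 !mxE /=.
have -> : forall a b : R,
    (a * (x * x) + b * (y * x)) * a + (a * (x * y) + b * (y * y)) * b =
    (a * x + b * y) ^+ 2 by move=> a b; ring.
exact: sqr_ge0.
Qed.

Lemma det_gram (R : realType) (x y : R) : \det (gram x y) = 0.
Proof. by rewrite det_mx22; have [-> -> -> ->] := gramE x y; ring. Qed.

(** The number [vec (x x^T) *m D *m (vec (y y^T))^T] for [x = (1, s)] and
    [y = (- s, 1)], expanded in powers of [s]. *)
Definition quartic (R : realType) (D : 'M[R]_3) (s : R) : R :=
  D j0 j1 + Num.sqrt 2 * (D j2 j1 - D j0 j2) * s
  + (D j0 j0 + D j1 j1 - 2 * D j2 j2) * s ^+ 2
  + Num.sqrt 2 * (D j2 j0 - D j1 j2) * s ^+ 3 + D j1 j0 * s ^+ 4.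

(** The velocity of [x x^T] under [D], tested against [y y^T], and the velocity of
    [y y^T] under [- D^T], tested against [x x^T], are opposite numbers. *)
Lemma polar_det_gram (R : realType) (D : 'M[R]_3) (s : R) :
  polar_det (gram 1 s) (velocity D (gram 1 s)) = quartic D s /\
  polar_det (gram (- s) 1) (velocity (- D^T) (gram (- s) 1)) = - quartic D s.
Proof.
have ss := sqrt2_sq R.
have two (a c d : R) : a - c * d - c * d = a - c * (2 * d) by ring.
split.
- have [P0 P1 P2 PE] := velocityE D (gram 1 s); have [G0 G1 G2 G3] := gramE 1 s.
  rewrite /polar_det PE P0 P1 G3 -G2 two P2 G0 G1 G2 /quartic.
  move: (Num.sqrt 2) ss => r rr; rewrite -[in RHS]rr; ring.
- have [P0 P1 P2 PE] := velocityE (- D^T) (gram (- s) 1).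
  have [G0 G1 G2 G3] := gramE (- s) 1.
  rewrite /polar_det PE P0 P1 G3 -G2 two P2 G0 G1 G2 /quartic.
  rewrite !mxE; move: (Num.sqrt 2) ss => r rr; rewrite -[in RHS]rr; ring.
Qed.

Lemma quartic_eq0_conformal (R : realType) (D : 'M[R]_3) :
  (forall s, quartic D s = 0) -> conformal D.
Proof.
(* Five values determine the five coefficients of a quartic. *)
move=> H; have := (H 0, H 1, H (-1), H 2, H (-2)).
rewrite /quartic !(mulr0, expr0n, addr0, mulr1, expr1n, mulrN1, sqrrN) /=.
move=> [[[[H0 H1] H2] H3] H4].
have s0 := sqrt2_neq0 R.
have cancel u : Num.sqrt 2 * u = 0 :> R -> u = 0.
  by move/eqP; rewrite mulf_eq0 (negbTE s0) => /eqP.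
set u := Num.sqrt 2 * (D j2 j1 - D j0 j2) in H1 H2 H3 H4.
set v := Num.sqrt 2 * (D j2 j0 - D j1 j2) in H1 H2 H3 H4.
have u0 : u = 0 by lra.
have v0 : v = 0 by lra.
move/cancel: u0 => u0; move/cancel: v0 => v0.
split; lra.
Qed.

Lemma mxrank_mxsub (F : fieldType) (m n m' n' : nat) (f : 'I_m' -> 'I_m)
    (g : 'I_n' -> 'I_n) (M : 'M[F]_(m, n)) :
  (\rank (mxsub f g M) <= \rank M)%N.
Proof.
have -> : mxsub f g M = rowsub f (M *m colsub g 1%:M).
  by rewrite mulmx_colsub mulmx1; apply/matrixP => i j; rewrite !mxE.
exact: leq_trans (mxrankS (rowsub_sub _ _)) (mxrankM_maxl _ _).
Qed.

(** The factorization writes [M] as a product through the space of all k x k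
    matrices. It shows that a matrix of rank 3 has psd rank at least 2. *)
Lemma mxrank_psd_size (R : realType) (p q k : nat) (M : 'M[R]_(p, q))
    (A : 'I_p -> 'M[R]_k) (B : 'I_q -> 'M[R]_k) :
  psd_factorization M A B -> (\rank M <= k * k)%N.
Proof.
case=> _ _ HM.
have -> : M = (\matrix_(i < p) mxvec (A i)) *m (\matrix_(j < q) mxvec (B j)^T)^T.
  apply/matrixP => i j; rewrite HM mxE (reindex _ (curry_mxvec_bij _ _)) /=.
  transitivity (\sum_a \sum_b A i a b * B j b a).
    by apply: eq_bigr => a _; rewrite mxE.
  rewrite pair_bigA; apply: eq_bigr => -[a b] _ /=.
  by rewrite !mxE !mxvecE mxE.
exact: leq_trans (mxrankM_maxr _ _) (rank_leq_row _).
Qed.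

(** For size 2 the product passes through the 3-dimensional space of symmetric
    matrices, which improves the bound 4 of [mxrank_psd_size]. *)
Lemma mxrank_psd2 (R : realType) (p q : nat) (M : 'M[R]_(p, q))
    (A : 'I_p -> 'M[R]_2) (B : 'I_q -> 'M[R]_2) :
  psd_factorization M A B -> (\rank M <= 3)%N.
Proof.
case=> psdA psdB HM.
have -> : M = (\matrix_(i < p) vec (A i)) *m (\matrix_(j < q) vec (B j))^T.
  apply/matrixP => i j; have [symA _] := psdA i; have [symB _] := psdB j.
  rewrite HM mxtrace_vec // !mxE; apply: eq_bigr => k _.
  by rewrite (mxE matrix_key (fun i => vec (A i) 0)) !(mxE trmx_key)
    (mxE matrix_key (fun j => vec (B j) 0)).
exact: leq_trans (mxrankM_maxr _ _) (rank_leq_row _).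
Qed.

Definition diff_sq (R : realType) (p q : nat) : 'M[R]_(p, q) :=
  \matrix_(i < p, j < q) ((i : nat)%:R - (j : nat)%:R) ^+ 2.

(** The inner product of [(1, t + i)] and [(- (t + j), 1)] is [i - j], whatever
    [t] is: one matrix has enough factorizations to exhibit every pair of
    orthogonal lines but one in its factors of index 0. *)
Lemma diff_sq_factorization (R : realType) (p q : nat) (t : R) :
  psd_factorization (diff_sq R p q)
    (fun i => gram 1 (t + (i : nat)%:R)) (fun j => gram (- (t + (j : nat)%:R)) 1).
Proof.
split; try by move=> k; exact: psd_gram.
move=> i j; rewrite mxE /mxtrace sum_ord2 !(mxE mulmx_key) !sum_ord2.
have [-> -> -> ->] := gramE 1 (t + (i : nat)%:R).
have [-> -> -> ->] := gramE (- (t + (j : nat)%:R)) 1.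
ring.
Qed.

Lemma M32_diff_sq (R : realType) (p q : nat) :
  (3 <= p)%N -> (3 <= q)%N -> M32 (diff_sq R p q).
Proof.
move=> hp hq; have fact := diff_sq_factorization p q (0 : R).
have rank3 : \rank (diff_sq R p q) = 3.
  apply/eqP; rewrite eqn_leq (mxrank_psd2 fact) /=.
  apply: leq_trans (mxrank_mxsub (widen_ord hp) (widen_ord hq) _).
  set N := mxsub _ _ _.
  (* The leading 3 x 3 block is invertible: here is its inverse. *)
  have /mulmx1_unit[Nunit _] : N *m (8^-1 *: mx_of_rows
      [:: [:: -1; 4; 1]; [:: 4; -16; 4]; [:: 1; 4; -1]]) = 1%:M.
    by apply/matrixP; do 2 apply: ord3P;
      rewrite mxE sum_ord3 !mxE /=; field.
  by rewrite mxrank_unit.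
split=> //; first by move=> i j; rewrite mxE sqr_ge0.
split=> [|k [A [B /mxrank_psd_size]]]; first by do 2 eexists; exact: fact.
by rewrite rank3; case: k A B => [|[|k]].
Qed.

Lemma trivial_motions_conformal (R : realType) (p q : nat) :
  (3 <= p)%N -> (3 <= q)%N -> trivial_motions R 1 p q = [set D | conformal D].
Proof.
case: p q => [//|p] [//|q] hp hq; have HM := M32_diff_sq R hp hq.
apply/seteqP; split=> D /=; last first.
  move=> cD; split=> [|M A B _ [psdA psdB _]]; last exact: conformal_gives_motion.
  have fact := diff_sq_factorization p.+1 q.+1 (0 : R).
  do 3 eexists; split; [exact: HM | exact: fact |].
  by case: fact => psdA psdB _; exact: conformal_gives_motion.
case=> _ H; apply: quartic_eq0_conformal => s.
have [dA [dB [gAB [symA symB _ [e e0 He]]]]] :=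
  H _ _ _ HM (diff_sq_factorization p.+1 q.+1 s).
have /(given_byP _ _ _ symA symB)[EA EB] := gAB.
(* The factors of index 0 on the two sides give opposite inequalities. *)
have [PA PB] := polar_det_gram D s.
have A0 : gram 1 (s + (ord0 : 'I_p.+1)%:R) = gram 1 s by rewrite addr0.
have B0 : gram (- (s + (ord0 : 'I_q.+1)%:R)) 1 = gram (- s) 1 by rewrite addr0.
apply/eqP; rewrite eq_le -oppr_ge0 -PB -PA; apply/andP; split.
- apply: (minors_nonneg_singular e0 (det_gram _ _)) => t /He[_ /(_ ord0)].
  by rewrite EB B0.
- apply: (minors_nonneg_singular e0 (det_gram _ _)) => t /He[/(_ ord0) + _].
  by rewrite EA A0.
Qed.

(** * Conformal matrices as derivatives of congruences *)

(** The derivative at [S = 1], in the direction [E], of the matrix [congruence S]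
    of the map [X |-> S^T X S]. *)
Definition dcongruence (R : realType) (E : 'M[R]_2) : 'M[R]_3 :=
  mx_of_rows
    [:: [:: 2 * E ord0 ord0; 0; Num.sqrt 2 * E ord0 ord_max];
        [:: 0; 2 * E ord_max ord_max; Num.sqrt 2 * E ord_max ord0];
        [:: Num.sqrt 2 * E ord_max ord0; Num.sqrt 2 * E ord0 ord_max;
            E ord0 ord0 + E ord_max ord_max]].

Definition mx22 (R : realType) (a b c d : R) : 'M[R]_2 :=
  \matrix_(i < 2, j < 2) (nth [::] [:: [:: a; b]; [:: c; d]] i)`_j.

Lemma mx3P (R : realType) (C D : 'M[R]_3) :
  C j0 j0 = D j0 j0 -> C j0 j1 = D j0 j1 -> C j0 j2 = D j0 j2 ->
  C j1 j0 = D j1 j0 -> C j1 j1 = D j1 j1 -> C j1 j2 = D j1 j2 ->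
  C j2 j0 = D j2 j0 -> C j2 j1 = D j2 j1 -> C j2 j2 = D j2 j2 -> C = D.
Proof. by move=> *; apply/matrixP; do 2 apply: ord3P. Qed.

Lemma conformalP (R : realType) (D : 'M[R]_3) :
  conformal D <-> exists E, D = dcongruence E.
Proof.
split=> [[d01 d10 d02 d12 d22]|[E ->]]; last by split; rewrite !mxE //=; ring.
exists (mx22 (D j0 j0 / 2) (D j2 j1 / Num.sqrt 2)
             (D j2 j0 / Num.sqrt 2) (D j1 j1 / 2)).
have s0 := sqrt2_neq0 R.
have mulVK (x y : R) : x != 0 -> x * (y / x) = y by move=> x0; field.
apply: mx3P; rewrite !mxE /= ?mulVK //; lra.
Qed.

Lemma span_dcongruence (R : realType) (D : 'M[R]_3) :
  D \in <<[:: D1 R; D2 R; D3 R; D4 R]>>%VS <-> exists E, D = dcongruence E.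
Proof.
rewrite !span_cons span_nil addv0; split.
  case/memv_addP=> _ /vlineP[a ->] [_ /memv_addP[_ /vlineP[b ->]
    [_ /memv_addP[_ /vlineP[c ->] [_ /vlineP[d ->] ->]] ->]] ->].
  exists (mx22 a d c b).
  by apply: mx3P; rewrite !mxE /=; ring.
case=> E ->.
have -> : dcongruence E = E ord0 ord0 *: D1 R + (E ord_max ord_max *: D2 R
    + (E ord_max ord0 *: D3 R + E ord0 ord_max *: D4 R)).
  by apply: mx3P; rewrite !mxE /=; ring.
by rewrite !memv_add // memvZ // memv_line.
Qed.

(** * The group of congruences *)

Definition congruence (R : realType) (S : 'M[R]_2) : 'M[R]_3 :=
  mx_of_rows
    [:: [:: S ord0 ord0 ^+ 2; S ord0 ord_max ^+ 2;
            Num.sqrt 2 * (S ord0 ord0 * S ord0 ord_max)];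
        [:: S ord_max ord0 ^+ 2; S ord_max ord_max ^+ 2;
            Num.sqrt 2 * (S ord_max ord0 * S ord_max ord_max)];
        [:: Num.sqrt 2 * (S ord0 ord0 * S ord_max ord0);
            Num.sqrt 2 * (S ord0 ord_max * S ord_max ord_max);
            S ord0 ord0 * S ord_max ord_max + S ord0 ord_max * S ord_max ord0]].

Lemma congruenceP (R : realType) (S : 'M[R]_2) : congruence_mx S (congruence S).
Proof.
move=> X /symmetric_mx2P XE; have [v0 v1 v2] := vecE X.
have [w0 w1 w2] := vecE (S^T *m X *m S).
apply/rowP; apply: ord3P; rewrite ?w0 ?w1 ?w2 [RHS]mxE sum_ord3 v0 v1 v2
  !mxE !sum_ord2 !mxE !sum_ord2 !mxE /= XE; have := sqrt2_sq R;
  move: (Num.sqrt 2) => s ss.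
- transitivity (X ord0 ord0 * S ord0 ord0 ^+ 2
    + X ord_max ord_max * S ord_max ord0 ^+ 2
    + (s * s) * X ord0 ord_max * (S ord0 ord0 * S ord_max ord0));
    [rewrite ss|]; ring.
- transitivity (X ord0 ord0 * S ord0 ord_max ^+ 2
    + X ord_max ord_max * S ord_max ord_max ^+ 2
    + (s * s) * X ord0 ord_max * (S ord0 ord_max * S ord_max ord_max));
    [rewrite ss|]; ring.
- ring.
Qed.

Lemma congruence_mx_inj (R : realType) (S : 'M[R]_2) (C C' : 'M[R]_3) :
  congruence_mx S C -> congruence_mx S C' -> C = C'.
Proof.
move=> HC HC'; apply/row_matrixP => i.
by rewrite !rowE -[delta_mx _ _]unvecK -HC ?unvec_sym // HC' // unvec_sym.
Qed.

Lemma congruence_mxM (R : realType) (S T : 'M[R]_2) (C C' : 'M[R]_3) :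
  congruence_mx S C -> congruence_mx T C' -> congruence_mx (S *m T) (C *m C').
Proof.
move=> HC HC' X Xsym.
have SXSsym : S^T *m X *m S \is symmetricmx.
  move/symmetric_mx2P: Xsym => XE; apply/symmetric_mx2P.
  by rewrite !mxE !sum_ord2 !mxE !sum_ord2 !mxE XE; ring.
by rewrite [RHS]mulmxA -HC // -HC' // trmx_mul !mulmxA.
Qed.

Lemma congruence_mx_inv (R : realType) (S T : 'M[R]_2) (C C' : 'M[R]_3) :
  S *m T = 1%:M -> congruence_mx S C -> congruence_mx T C' ->
  C *m C' = 1%:M.
Proof.
move=> ST HC HC'; apply: (@congruence_mx_inj _ 1%:M).
  by rewrite -ST; exact: congruence_mxM.
by move=> X _; rewrite trmx1 mul1mx !mulmx1.
Qed.

Lemma M_GL2P (R : realType) (C C' : 'M[R]_3) : M_GL2 R (C, C') ->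
  (exists S, C = congruence S) /\ C *m C' = 1%:M.
Proof.
case=> S [C0 [Sunit HC [-> ->]]].
split; first by exists S; apply: congruence_mx_inj HC (congruenceP S).
have := congruence_mx_inv (mulmxV Sunit) HC (congruenceP _).
by move=> /mulmx1_unit[C0unit _]; rewrite mulmxV.
Qed.

Lemma M_GL2_congruence (R : realType) (S T : 'M[R]_2) :
  S *m T = 1%:M -> M_GL2 R (congruence S, congruence T).
Proof.
move=> ST; exists S, (congruence S); split; [|exact: congruenceP|].
  by case/mulmx1_unit: ST.
have CC := congruence_mx_inv ST (congruenceP S) (congruenceP T).
have [Cunit _] := mulmx1_unit CC.
by rewrite -[X in (_, X) = _](mulKmx Cunit) CC mulmx1.
Qed.

(** The entries of [C J C^T]. *)
Definition row_form (R : realType) (C : 'M[R]_3) (i k : 'I_3) : R :=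
  C i j0 * C k j1 + C i j1 * C k j0 - C i j2 * C k j2.

(** [C_S J C_S^T] is [det S ^ 2] times [J], because [det (S^T X S)] is
    [det S ^ 2 * det X]; the scalar is eliminated by the last equation. *)
Lemma row_form_congruence (R : realType) (S : 'M[R]_2) :
  let F := row_form (congruence S) in
  [/\ F j0 j0 = 0, F j1 j1 = 0, F j0 j2 = 0, F j1 j2 = 0 & F j0 j1 + F j2 j2 = 0].
Proof.
have := sqrt2_sq R; rewrite /row_form !mxE /=; move: (Num.sqrt 2) => s ss.
(* Equality modulo the relation [s * s = 2], with the cofactor [c]. *)
have mod_ss (a c : R) : a = (2 - s * s) * c -> a = 0 by rewrite ss subrr mul0r.
split.
- by apply: (mod_ss _ ((S ord0 ord0 * S ord0 ord_max) ^+ 2)); ring.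
- by apply: (mod_ss _ ((S ord_max ord0 * S ord_max ord_max) ^+ 2)); ring.
- ring.
- ring.
- apply: (mod_ss _ (
    (S ord0 ord0 * S ord0 ord_max) * (S ord_max ord0 * S ord_max ord_max)
    - 2 * (S ord0 ord0 * S ord_max ord0) * (S ord0 ord_max * S ord_max ord_max))).
  ring.
Qed.

(** * Derivatives of curves of matrices *)

Lemma is_derive_cvg (R : realType) (V : normedModType R) (f : R -> V) (x : R) (df : V) :
  is_derive x 1 f df <->
  h^-1 *: (f (h *: (1 : R) + x) - f x) @[h --> (0 : R)^'] --> df.
Proof.
split=> [[fx <-] //|fxdf].
by apply: DeriveDef; [apply/cvg_ex; exists df | exact: cvg_lim].
Qed.

Lemma is_derive_pairP (R : realType) (V W : normedModType R) (f : R -> V * W)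
    (x : R) (dv : V) (dw : W) :
  is_derive x 1 f (dv, dw) <->
  is_derive x 1 (fun t => (f t).1) dv /\ is_derive x 1 (fun t => (f t).2) dw.
Proof.
rewrite !is_derive_cvg; split=> [H|[H1 H2]].
- split.
  + exact: (cvg_comp _ _ H (@cvg_fst _ _ (nbhs dv) (nbhs dw) _)).
  + exact: (cvg_comp _ _ H (@cvg_snd _ _ (nbhs dv) (nbhs dw) _)).
- exact: (cvg_pair H1 H2).
Qed.

Lemma is_derive_mxP (R : realType) (m n : nat) (f : R -> 'M[R]_(m, n)) (x : R)
    (df : 'M[R]_(m, n)) :
  is_derive x 1 f df <->
  forall i j, is_derive x 1 (fun t => f t i j) (df i j).
Proof.
split=> [[fx <-] i j|H].
  apply: DeriveDef; first by move/derivable_mxP: fx => /(_ i j).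
  by rewrite derive_mx // mxE.
have fx : derivable f x 1 by apply/derivable_mxP => i j; case: (H i j).
apply: DeriveDef => //; apply/matrixP => i j.
by rewrite derive_mx // mxE; case: (H i j).
Qed.

(** Stated on explicit lambdas, these rules compose into the derivative of a
    polynomial in the entries of a curve of matrices. *)
Lemma is_derive_add (R : realType) (f g : R -> R) (x df dg : R) :
  is_derive x 1 f df -> is_derive x 1 g dg ->
  is_derive x 1 (fun t => f t + g t) (df + dg).
Proof. by move=> *; exact: is_deriveD. Qed.

Lemma is_derive_sub (R : realType) (f g : R -> R) (x df dg : R) :
  is_derive x 1 f df -> is_derive x 1 g dg ->
  is_derive x 1 (fun t => f t - g t) (df - dg).
Proof. by move=> *; exact: is_deriveB. Qed.

Lemma is_derive_mul (R : realType) (f g : R -> R) (x df dg : R) :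
  is_derive x 1 f df -> is_derive x 1 g dg ->
  is_derive x 1 (fun t => f t * g t) (f x * dg + g x * df).
Proof. by move=> *; exact: is_deriveM. Qed.

Lemma is_derive_scale (R : realType) (f : R -> R) (x df : R) (c : R) :
  is_derive x 1 f df -> is_derive x 1 (fun t => c * f t) (c * df).
Proof. by move=> ?; exact: is_deriveZ. Qed.

Lemma is_derive_inv (R : realType) (f : R -> R) (x df : R) :
  is_derive x 1 f df -> f x != 0 ->
  is_derive x 1 (fun t => (f t)^-1) (- (f x) ^- 2 * df).
Proof.
case=> fx <- fx0.
by apply: DeriveDef; [exact: derivableV | rewrite deriveV].
Qed.

Lemma is_derive_near_eq0 (R : realType) (f : R -> R) (x df : R) :
  is_derive x 1 f df -> (\forall t \near x, f t = 0) -> df = 0.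
Proof.
move=> Hf f0.
have H0 : is_derive x 1 f 0.
  apply: (near_eq_is_derive _ (is_derive_cst (0 : R) x 1)).
  by near=> t; rewrite /cst; apply/esym; near: t.
by case: Hf => _ <-; case: H0.
Unshelve. all: by end_near. Qed.

Lemma is_derive_ext (R : realType) (f g : R -> R) (x a b : R) :
  is_derive x 1 f a -> f =1 g -> a = b -> is_derive x 1 g b.
Proof. by move=> df /funext <- <-. Qed.

(** * Tangent directions *)

(** Differentiate at the identity the equations [row_form_congruence] and
    [C_S C_S^-1 = 1], which hold along the curve. *)
Lemma tangent_conformal (R : realType) (D D' : 'M[R]_3) :
  tangent_directions (M_GL2 R) (1%:M, 1%:M) (D, D') -> conformal D /\ D' = - D.
Proof.
case=> gamma [g0 gN /is_derive_pairP[/is_derive_mxP dC /is_derive_mxP dC']].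
have C0 : (gamma 0).1 = 1%:M by rewrite g0.
have C'0 : (gamma 0).2 = 1%:M by rewrite g0.
have gE : \forall t \near (0 : R),
    (exists S, (gamma t).1 = congruence S) /\ (gamma t).1 *m (gamma t).2 = 1%:M.
  near=> t; apply: M_GL2P.
  by rewrite -surjective_pairing; near: t.
split.
- have dF i k := is_derive_sub (is_derive_add
    (is_derive_mul (dC i j0) (dC k j1)) (is_derive_mul (dC i j1) (dC k j0)))
    (is_derive_mul (dC i j2) (dC k j2)).
  have F0 : \forall t \near (0 : R), let F := row_form (gamma t).1 in
      [/\ F j0 j0 = 0, F j1 j1 = 0, F j0 j2 = 0, F j1 j2 = 0 & F j0 j1 + F j2 j2 = 0].
    by apply: filterS gE => t [[S ->] _]; exact: row_form_congruence.
  have e1 := is_derive_near_eq0 (dF j0 j0).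
  have e2 := is_derive_near_eq0 (dF j1 j1).
  have e3 := is_derive_near_eq0 (dF j0 j2).
  have e4 := is_derive_near_eq0 (dF j1 j2).
  have e5 := is_derive_near_eq0 (is_derive_add (dF j0 j1) (dF j2 j2)).
  have /e1 {}e1 : \forall t \near (0 : R), row_form (gamma t).1 j0 j0 = 0.
    by apply: filterS F0 => t [].
  have /e2 {}e2 : \forall t \near (0 : R), row_form (gamma t).1 j1 j1 = 0.
    by apply: filterS F0 => t [].
  have /e3 {}e3 : \forall t \near (0 : R), row_form (gamma t).1 j0 j2 = 0.
    by apply: filterS F0 => t [].
  have /e4 {}e4 : \forall t \near (0 : R), row_form (gamma t).1 j1 j2 = 0.
    by apply: filterS F0 => t [].
  have /e5 {}e5 : \forall t \near (0 : R),
      row_form (gamma t).1 j0 j1 + row_form (gamma t).1 j2 j2 = 0.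
    by apply: filterS F0 => t [].
  move: e1 e2 e3 e4 e5; rewrite C0 !mxE /= => e1 e2 e3 e4 e5.
  by split; lra.
- have CC' i k : D i k + D' i k = 0.
    have := is_derive_near_eq0 (is_derive_sub (is_derive_add (is_derive_add
      (is_derive_mul (dC i j0) (dC' j0 k)) (is_derive_mul (dC i j1) (dC' j1 k)))
      (is_derive_mul (dC i j2) (dC' j2 k)))
      (is_derive_cst ((1%:M : 'M[R]_3) i k) (0 : R) 1)).
    rewrite C0 C'0 !mxE => <-; last first.
      apply: filterS gE => t [_ /matrixP/(_ i k)].
      by rewrite !mxE sum_ord3 => ->; exact: subrr.
    by move: i k; do 2 apply: ord3P; rewrite /= ?mxE; ring.
  by apply/matrixP => i k; rewrite mxE; apply/eqP; rewrite -addr_eq0 addrC CC'.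
Unshelve. all: by end_near. Qed.

Lemma is_derive_congruence (R : realType) (S : R -> 'M[R]_2) (E : 'M[R]_2) :
  S 0 = 1%:M -> is_derive (0 : R) 1 S E ->
  is_derive (0 : R) 1 (fun t => congruence (S t)) (dcongruence E).
Proof.
move=> S0 /is_derive_mxP dS; apply/is_derive_mxP.
have dM i j k l := is_derive_mul (dS i j) (dS k l).
have dMs i j k l := is_derive_scale (Num.sqrt 2) (dM i j k l).
do 2 apply: ord3P.
- by apply: is_derive_ext (dM ord0 ord0 ord0 ord0) _ _ => [t|];
    rewrite ?S0 !mxE //=; ring.
- by apply: is_derive_ext (dM ord0 ord_max ord0 ord_max) _ _ => [t|];
    rewrite ?S0 !mxE //=; ring.
- by apply: is_derive_ext (dMs ord0 ord0 ord0 ord_max) _ _ => [t|];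
    rewrite ?S0 !mxE //=; ring.
- by apply: is_derive_ext (dM ord_max ord0 ord_max ord0) _ _ => [t|];
    rewrite ?S0 !mxE //=; ring.
- by apply: is_derive_ext (dM ord_max ord_max ord_max ord_max) _ _ => [t|];
    rewrite ?S0 !mxE //=; ring.
- by apply: is_derive_ext (dMs ord_max ord0 ord_max ord_max) _ _ => [t|];
    rewrite ?S0 !mxE //=; ring.
- by apply: is_derive_ext (dMs ord0 ord0 ord_max ord0) _ _ => [t|];
    rewrite ?S0 !mxE //=; ring.
- by apply: is_derive_ext (dMs ord0 ord_max ord_max ord_max) _ _ => [t|];
    rewrite ?S0 !mxE //=; ring.
- by apply: is_derive_ext (is_derive_add (dM ord0 ord0 ord_max ord_max)
    (dM ord0 ord_max ord_max ord0)) _ _ => [t|]; rewrite ?S0 !mxE //=; ring.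
Qed.

Lemma congruence1 (R : realType) : congruence (1%:M : 'M[R]_2) = 1%:M.
Proof. by apply: mx3P; rewrite !mxE //=; ring. Qed.

Lemma dcongruenceN (R : realType) (E : 'M[R]_2) : dcongruence (- E) = - dcongruence E.
Proof. by apply: mx3P; rewrite !mxE //=; ring. Qed.

(** The curve is [S t = 1 + t E]. Its inverse is written as the adjugate, again
    affine in [t], over the determinant, to be differentiated entry by entry; the
    inverse of [C_S] is the congruence matrix of this inverse. *)
Lemma dcongruence_tangent (R : realType) (E : 'M[R]_2) :
  tangent_directions (M_GL2 R) (1%:M, 1%:M) (dcongruence E, - dcongruence E).
Proof.
pose E' := mx22 (E ord_max ord_max) (- E ord0 ord_max) (- E ord_max ord0) (E ord0 ord0).
pose S t : 'M[R]_2 := 1%:M + t *: E.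
pose d t := \det (S t).
pose T t : 'M[R]_2 := (d t)^-1 *: (1%:M + t *: E').
have S0 : S 0 = 1%:M by rewrite /S scale0r addr0.
have d0 : d 0 = 1 by rewrite /d S0 det1.
have T0 : T 0 = 1%:M by rewrite /T d0 invr1 scale1r scale0r addr0.
have affine (c a : R) : is_derive (0 : R) 1 (fun t => c + t * a) a.
  have aff := is_derive_add (is_derive_cst c (0 : R) 1)
    (is_derive_mul (is_derive_id (0 : R) 1) (is_derive_cst a (0 : R) 1)).
  by apply: is_derive_ext aff _ _ => [t|] //=; rewrite /cst; ring.
have dd : is_derive (0 : R) 1 d (E ord0 ord0 + E ord_max ord_max).
  have dS2 := is_derive_sub
    (is_derive_mul (affine 1 (E ord0 ord0)) (affine 1 (E ord_max ord_max)))
    (is_derive_mul (affine 0 (E ord0 ord_max)) (affine 0 (E ord_max ord0))).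
  apply: is_derive_ext dS2 _ _ => [t|]; last by ring.
  by rewrite /d det_mx22 !mxE.
have d0neq0 : d 0 != 0 by rewrite d0 oner_neq0.
have dS : is_derive (0 : R) 1 S E.
  apply/is_derive_mxP => i j.
  apply: is_derive_ext (affine (i == j)%:R (E i j)) _ _ => // t.
  by rewrite !mxE.
have dT : is_derive (0 : R) 1 T (- E).
  apply/is_derive_mxP => i j.
  apply: is_derive_ext
    (is_derive_mul (is_derive_inv dd d0neq0) (affine (i == j)%:R (E' i j))) _ _ => [t|].
    by rewrite !mxE.
  rewrite d0; move: i j; do 2 apply: ord2P; by rewrite !mxE /=; field.
exists (fun t => (congruence (S t), congruence (T t))); split.
- by rewrite S0 T0 congruence1.
- have dneq0 : \forall t \near (0 : R), d t != 0.
    have dd0 : derivable d 0 1 by case: dd.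
    have /derivable1_diffP/differentiable_continuous dcont := dd0.
    exact: (cvgr_neq0 _ dcont d0neq0).
  near=> t; apply: M_GL2_congruence.
  have : d t != 0 by near: t.
  have SE' : S t *m (1%:M + t *: E') = (d t)%:M.
    by apply: mx2P; rewrite /d det_mx22 !mxE sum_ord2 !mxE /=; ring.
  by move=> dt; rewrite /T -scalemxAr SE' scale_scalar_mx mulVf.
- apply/is_derive_pairP; split; first exact: is_derive_congruence.
  by rewrite -dcongruenceN; exact: is_derive_congruence.
Unshelve. all: by end_near. Qed.

Theorem theorem2 (R : realType) (p q : nat) (hp : (3 <= p)%N) (hq : (3 <= q)%N) :
  [set (D, - D) | D in trivial_motions R 1 p q] =
    tangent_directions (M_GL2 R) (1%:M, 1%:M) /\
  trivial_motions R 1 p q =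
    [set D | D \in <<[:: D1 R; D2 R; D3 R; D4 R]>>%VS].
Proof.
rewrite trivial_motions_conformal //; split.
- apply/seteqP; split=> [_ [D /conformalP[E ->] <-]|[D D']].
    exact: dcongruence_tangent.
  by move/tangent_conformal=> [cD ->]; exists D.
- apply/seteqP; split=> D /=; first by move/conformalP/span_dcongruence.
  by move/span_dcongruence/conformalP.
Qed.
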